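(* Let $r\ge 2$ and $s\ge 1$ be integers. There are constants $n_0$ and $C$ depending only on $r$ and $s$ such that for all $n\ge n_0$, \[ \bigl|\,\mathrm{ex}_r(n,\mathrm{Tr}_r(M_{s+1}))-f_{r-1}(s)\cdot n\,\bigr|\le C , \] i.e. $\mathrm{ex}_r(n,\mathrm{Tr}_r(M_{s+1}))=f_{r-1}(s)\cdot n+O_{r,s}(1)$ when $n$ is sufficiently large. Moreover, the following construction achieves the asymptotic bound. Let $\mathcal{G}$ be an $(r-1)$-uniform hypergraph with $f_{r-1}(s)$ hyperedges, with $\phi(\mathcal{G})\le s$ and without isolated vertices. Let $\mathcal{H}$ be the $r$-uniform hypergraph on a set of $n$ vertices containing $V(\mathcal{G})$ whose hyperedges are exactly the sets $\{v\}\cup e$ with $v\notin V(\mathcal{G})$ and $e\in E(\mathcal{G})$. Then $\mathcal{H}$ does not contain $M_{s+1}$ as a trace and $e(\mathcal{H})=f_{r-1}(s)\cdot n+O_{r,s}(1)$.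
   Context: All hypergraphs are finite; a hypergraph is $r$-uniform if all hyperedges have size $r$. $e(\mathcal{H})$ is the number of hyperedges of $\mathcal{H}$ and $v(\mathcal{H})$ the number of vertices. $M_{s+1}$ is the graph (a matching) consisting of $s+1$ pairwise disjoint edges, on $2(s+1)$ vertices. Trace: for a hypergraph $\mathcal{H}$ and $S\subseteq V(\mathcal{H})$, the trace of $\mathcal{H}$ on $S$ is the hypergraph $\mathcal{H}_{|S}$ on $S$ with hyperedge set $\{e\cap S: e\in E(\mathcal{H})\}$. $\mathcal{H}$ contains a (hyper)graph $F$ as a trace if there is $S\subseteq V(\mathcal{H})$ with $|S|=v(F)$ such that $\mathcal{H}_{|S}$ contains $F$ as a sub-hypergraph. $\mathrm{Tr}_r(F)$ denotes the family of minimal $r$-uniform hypergraphs containing $F$ as a trace, and $\mathrm{ex}_r(n,\mathrm{Tr}_r(F))$ is the maximum number of hyperedges in an $r$-uniform hypergraph on $n$ vertices not containing $F$ as a trace. Domination: a set $D\subseteq V(\mathcal{H})$ is a dominating set of a uniform hypergraph $\mathcal{H}$ if for every vertex $v\notin D$ there is a hyperedge $e$ with $v\in e$ and $e\setminus\{v\}\subseteq D$. A set of vertices is a dominated set if its complement in $V(\mathcal{H})$ is a dominating set. The dominated number $\phi(\mathcal{H})$ is the maximum size of a dominated set. $f_r(s)$ is the maximum number of hyperedges of an $r$-uniform hypergraph (on any finite number of vertices) with dominated number at most $s$. *)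

(* Defs.v *)
From HB Require Import structures.
From mathcomp Require Import all_boot all_order all_algebra.
From mathcomp Require Import boolp.

Set Implicit Arguments.
Unset Strict Implicit.
Unset Printing Implicit Defensive.

(* The vertex set is a subset of an ambient finite type, so that several
   hypergraphs (a hypergraph and its traces, say) can share vertices. *)
Record hypergraph (T : finType) := Hypergraph {
  vertices_edges : {set T} * {set {set T}};
  edges_sub : [forall e in vertices_edges.2, e \subset vertices_edges.1] }.

HB.instance Definition _ (T : finType) :=
  [isSub of hypergraph T for @vertices_edges T].
HB.instance Definition _ (T : finType) := [Finite of hypergraph T by <:].

Section Hypergraphs.
Variable T : finType.
Implicit Types (H : hypergraph T) (S D A : {set T}).

Definition vertices H : {set T} := (vertices_edges H).1.
Definition edges H : {set {set T}} := (vertices_edges H).2.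

Definition uniform (r : nat) H : bool := [forall e in edges H, #|e| == r].

Definition no_isolated H : bool :=
  [forall v in vertices H, exists e in edges H, v \in e].

Lemma trace_sub H S :
  [forall e in [set e :&: S | e in edges H], e \subset S].
Proof. by apply/forall_inP => _ /imsetP[e _ ->]; apply: subsetIr. Qed.

Definition trace H S : hypergraph T :=
  @Hypergraph T (S, [set e :&: S | e in edges H]) (trace_sub H S).

Definition dominating H D : bool :=
  (D \subset vertices H) &&
  [forall v in vertices H :\: D,
     exists e in edges H, (v \in e) && (e :\ v \subset D)].

Definition dominated H A : bool :=
  (A \subset vertices H) && dominating H (vertices H :\: A).

Definition phi H : nat := \max_(A : {set T} | dominated H A) #|A|.

End Hypergraphs.

(* H has a sub-hypergraph isomorphic to F; only the values of g on the
   vertices of F matter. *)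
Definition contains_copy (U T : finType) (F : hypergraph U)
    (H : hypergraph T) : bool :=
  [exists g : {ffun U -> T},
    [&& dinjectiveb g (mem (vertices F)),
        g @: vertices F \subset vertices H
      & [forall e in edges F, g @: e \in edges H]]].

Definition contains_trace (U T : finType) (F : hypergraph U)
    (H : hypergraph T) : bool :=
  [exists S : {set T},
    [&& S \subset vertices H, #|S| == #|vertices F|
      & contains_copy F (trace H S)]].

Definition ex_trace (U : finType) (r n : nat) (F : hypergraph U) : nat :=
  \max_(H : hypergraph 'I_n |
      [&& #|vertices H| == n, uniform r H & ~~ contains_trace F H])
    #|edges H|.

Lemma matching_sub (k : nat) :
  [forall e in [set [set (i, false); (i, true)] | i : 'I_k],
     e \subset [set: 'I_k * bool]].
Proof. by apply/forall_inP => e _; apply: subsetT. Qed.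

Definition matching (k : nat) : hypergraph ('I_k * bool)%type :=
  @Hypergraph _ ([set: 'I_k * bool], [set [set (i, false); (i, true)] | i : 'I_k])
    (matching_sub k).

(* m is the number of edges of some r-uniform hypergraph, on any finite number
   of vertices, with dominated number at most s. *)
Definition edge_count_phi_le (r s m : nat) : bool :=
  `[< exists (T : finType) (G : hypergraph T),
        [/\ uniform r G, phi G <= s & #|edges G| = m] >].

Lemma edge_count_phi_le_ex (r s : nat) : exists m, edge_count_phi_le r s m.
Proof.
have P : [forall e in (set0 : {set {set void}}), e \subset (set0 : {set void})].
  by apply/forall_inP => e; rewrite inE.
exists 0; apply/asboolP; exists void, (@Hypergraph _ (set0, set0) P).
split; last by rewrite /edges cards0.
  by apply/forall_inP => e; rewrite inE.
by apply/bigmax_leqP => A _; rewrite (leq_trans (max_card _)) ?card_void.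
Qed.

(* A minimal subfamily of edges covering all non-isolated vertices has a private
   vertex in each member, and these private vertices form a dominated set. *)
Lemma card_cover_phi (T : finType) (r : nat) (G : hypergraph T) :
  uniform r G -> #|cover (edges G)| <= phi G * r.
Proof.
move=> /forall_inP uG.
pose P (C : {set {set T}}) :=
  (C \subset edges G) && (cover C == cover (edges G)).
have PE : P (edges G) by rewrite /P subxx eqxx.
have [C /minsetP[/andP[sCE /eqP covC] minC] _] := minset_exists PE.
pose Q (e : {set T}) x := (x \in e) && [forall e' in C, (x \in e') ==> (e' == e)].
have priv e : e \in C -> exists x, Q e x.
  move=> eC; apply/existsP; apply: contraT; rewrite negb_exists => /forallP nP.
  suff /minC/(_ (subsetDl _ _)) eqC : P (C :\ e).
    by move: eC; rewrite -eqC !inE eqxx.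
  rewrite /P (subset_trans (subsetDl _ _) sCE) /= -covC eqEsubset.
  apply/andP; split; apply/subsetP => x /bigcupP[e1 e1C xe1].
    by apply/bigcupP; exists e1 => //; case/setD1P: e1C.
  have [e1e|ne] := eqVneq e1 e; last first.
    by apply/bigcupP; exists e1 => //; rewrite !inE ne.
  subst e1; have := nP x; rewrite /Q xe1 /= negb_forall => /existsP[e2].
  rewrite !negb_imply => /and3P[e2C xe2 ne].
  by apply/bigcupP; exists e2 => //; rewrite !inE ne.
have privE e e' x : Q e x -> e' \in C -> x \in e' -> e' = e.
  by case/andP=> _ /forall_inP h e'C xe'; apply/eqP; apply: (implyP (h _ e'C)).
have [C0|[e0 e0C]] := set_0Vmem C.
  by rewrite -covC C0 /cover big_set0 cards0.
have [x0 _] := priv _ e0C.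
pose p e := odflt x0 [pick x | Q e x].
have Qp e : e \in C -> Q e (p e).
  move=> /priv[x Qx]; rewrite /p; case: pickP => [//|/(_ x)].
  by rewrite Qx.
have p_in e e' : e \in C -> e' \in C -> p e \in e' -> e' = e.
  by move=> /Qp Qe; apply: privE.
have pe e : e \in C -> p e \in e by move=> /Qp/andP[].
have eV e w : e \in edges G -> w \in e -> w \in vertices G.
  by move=> eE; have /forall_inP/(_ e eE)/subsetP := edges_sub G; apply.
have domA : dominated G (p @: C).
  have AV : p @: C \subset vertices G.
    apply/subsetP => _ /imsetP[e eC ->].
    by apply: (eV e); [apply: (subsetP sCE) | apply: pe].
  rewrite /dominated AV /dominating subsetDl /=.
  apply/forall_inP => v /setDP[vV]; rewrite in_setD vV andbT negbK.
  case/imsetP => e eC ->; apply/exists_inP; exists e; first exact: (subsetP sCE).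
  rewrite pe //=; apply/subsetP => w /setD1P[wv we].
  rewrite in_setD (eV e) ?(subsetP sCE) // andbT.
  apply: contra wv => /imsetP[e' e'C wE].
  by rewrite wE (p_in e' e) // -wE.
have cA : #|p @: C| = #|C|.
  apply: card_in_imset => e e' eC e'C ee'.
  by apply: (p_in e' e) => //; rewrite -ee' pe.
rewrite -covC (leq_trans (n := #|C| * r)) //; last first.
  by rewrite leq_mul2r -cA [_ <= phi G](leq_bigmax_cond (P := dominated G)) ?orbT.
rewrite (leq_trans (leq_card_cover C)) // -sum_nat_const leq_sum // => e eC.
by rewrite (eqP (uG _ _)) // (subsetP sCE).
Qed.

Lemma edge_count_phi_le_bound (r s m : nat) :
  edge_count_phi_le r s m -> m <= 2 ^ (s * r).
Proof.
move=> /asboolP[T [G [uG phiG <-]]].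
have /subset_leq_card : edges G \subset powerset (cover (edges G)).
  by apply/subsetP => e eE; rewrite powersetE (bigcup_max e).
rewrite card_powerset => /leq_trans; apply; rewrite leq_exp2l //.
by rewrite (leq_trans (card_cover_phi uG)) // leq_mul2r phiG orbT.
Qed.

(* f_r(s); ex_maxnP gives its characterisation as a maximum. *)
Definition max_edges_phi (r s : nat) : nat :=
  ex_maxn (edge_count_phi_le_ex r s) (@edge_count_phi_le_bound r s).

(* Main.v *)
Require Import Defs.
From mathcomp Require Import all_boot all_order all_algebra.
From mathcomp Require Import boolp zify.

Set Implicit Arguments.
Unset Strict Implicit.
Unset Printing Implicit Defensive.

(** Both sides of the theorem are statements about private vertices, where a
    vertex of a member of a family of edges is private if no other member
    contains it.  The dominated number of [G] exceeds [s] exactly when [G] has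
    [s + 1] edges with a private vertex each ([phi_gtP]); [H] contains
    [M_(s+1)] as a trace exactly when [H] has [s + 1] edges with two private
    vertices each ([contains_matching_traceP]).  In the rest of
    this comment [H] is [(r+1)]-uniform and [G] is [r]-uniform, so that
    [f_r(s)] is the constant in question.

    Lower bound.  Suppose that every edge of [H] is an edge of [G] with one
    vertex added.  Of two private vertices of an edge of [H], at least one lies
    in the underlying edge of [G] and is private there; so [phi G <= s]
    prevents an [M_(s+1)] trace ([no_matching_trace_cone]).  If the added
    vertex ranges over all vertices outside [G], the number of edges is
    [#|edges G| * (n - #|vertices G|)], and [#|vertices G| <= s * r] when [G]
    has no isolated vertices ([card_cover_phi]).

    Upper bound.  Let [H] have no [M_(s+1)] trace.  A sunflower with [s + 1]
    petals of size at least 2 would give one, since each petal supplies two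
    private vertices.  Hence, for a fixed set [W] and a fixed intersection
    [A] with [W] missing at least 2 vertices of an edge, the edges that meet
    [W] in [A] can all be stabbed outside [W] by a bounded set
    ([petals_meet_bounded_set]).  Adding these stabbing sets to [W] and
    repeating yields a set [W] of bounded size which contains all vertices but
    at most one of every edge ([core_exists]).  Up to a bounded number of
    edges, [H] therefore consists of edges [v |: A] where [A] is an [r]-subset
    of [W] that extends to an edge by more than [s] vertices [v] outside [W].
    These heavy sets [A] form a hypergraph [G] with [phi G <= s]: given
    [s + 1] heavy sets with a private vertex each, distinct extending vertices
    can be chosen, and they become second private vertices
    ([phi_heavy_le]).  So there are at most [f_r(s)] heavy sets, and each
    accounts for at most [n] edges. *)

(** * Private vertices *)

Lemma edge_sub_vertices (T : finType) (H : hypergraph T) (e : {set T}) :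
  e \in edges H -> e \subset vertices H.
Proof. exact: (forall_inP (edges_sub H)). Qed.

Lemma card_edge (T : finType) (H : hypergraph T) (r : nat) (e : {set T}) :
  uniform r H -> e \in edges H -> #|e| = r.
Proof. by move=> /forall_inP uH eE; apply/eqP; apply: uH. Qed.

(** The vertices of [e] other than [v] avoid [A] exactly when [v] is the only
    vertex of [e] in [A].  In this form domination no longer refers to the
    vertex set, so isolated vertices can be added or removed freely. *)
Lemma dominatedP (T : finType) (G : hypergraph T) (A : {set T}) :
  reflect (forall v, v \in A -> exists2 e, e \in edges G & e :&: A = [set v])
          (dominated G A).
Proof.
apply: (iffP idP) => [/and3P[/subsetP AV _ /forall_inP domA] v vA | privA].
  have vVD : v \in vertices G :\: (vertices G :\: A).
    by rewrite !inE vA AV.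
  have /exists_inP[e eE /andP[ve /subsetP eA]] := domA v vVD.
  exists e => //; apply/setP => x; rewrite !inE.
  have [->|xv] := eqVneq x v; first by rewrite ve vA.
  apply/andP => -[xe xA]; have := eA x; rewrite !inE xv xe xA.
  by move=> /(_ isT).
rewrite /dominated /dominating subsetDl /=; apply/andP; split.
  apply/subsetP => v /privA[e /edge_sub_vertices/subsetP eV eA].
  by apply: eV; have := set11 v; rewrite -eA inE => /andP[].
apply/forall_inP => v; rewrite !inE => /andP[vA vV].
rewrite vV andbT negbK in vA; have [e eE eA] := privA v vA.
apply/exists_inP; exists e => //; apply/andP; split.
  by have := set11 v; rewrite -eA inE => /andP[].
apply/subsetP => x; rewrite !inE => /andP[xv xe].
rewrite (subsetP (edge_sub_vertices eE)) // andbT.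
by apply: contra xv => xA; rewrite -in_set1 -eA inE xe.
Qed.

(** A transversal of private vertices is a dominated set; conversely, the
    edges dominating the points of a dominated set have these points as
    private vertices. *)
Lemma phi_gtP (T : finType) (G : hypergraph T) (s : nat) :
  s < phi G <->
  exists (a : 'I_s.+1 -> T) (e : 'I_s.+1 -> {set T}),
    (forall i, e i \in edges G) /\ (forall i j, (a i \in e j) = (i == j)).
Proof.
split=> [s_lt | [a [e [eE ae]]]].
  have [A /dominatedP domA sA] : exists2 A, dominated G A & s < #|A|.
    apply/exists_inP; apply: contraTT s_lt => /exists_inPn noA.
    by rewrite -leqNgt; apply/bigmax_leqP => A /noA; rewrite -leqNgt.
  have sAi (i : 'I_s.+1) : i < #|A| by rewrite (leq_trans (ltn_ord i)).
  pose a i := enum_val (Ordinal (sAi i)).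
  have aA i : a i \in A by apply: enum_valP.
  have /(_ _)/cid2 priv i := domA _ (aA i).
  exists a, (fun i => projT1 (priv i)).
  split=> [i|i j]; case: (priv _) => //= e _ eA.
  have -> : (a i \in e) = (a i \in e :&: A) by rewrite inE aA andbT.
  by rewrite eA inE (inj_eq enum_val_inj) -val_eqE.
have a_inj : injective a by move=> i j aij; apply/eqP; rewrite -ae aij ae.
have domA : dominated G (a @: setT).
  apply/dominatedP => _ /imsetP[i _ ->]; exists (e i) => //.
  apply/setP => x; rewrite !inE; apply/andP/eqP => [[xe]|->].
    by case/imsetP=> j _ xj; move: xe; rewrite xj ae => /eqP->.
  by rewrite ae imset_f.
have := leq_bigmax_cond (P := dominated G) (F := fun A => #|A|) _ domA.
by rewrite card_imset // cardsT card_ord.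
Qed.

(** The set [S] carrying the trace consists of the points [p i c], and the edge
    whose trace is the [i]-th pair contains no other point of [S]. *)
Lemma contains_matching_traceP (T : finType) (H : hypergraph T) (t : nat) :
  contains_trace (matching t) H <->
  exists (p : 'I_t -> bool -> T) (e : 'I_t -> {set T}),
    [/\ forall i, e i \in edges H, forall i, p i false != p i true
      & forall i c j, (p i c \in e j) = (i == j)].
Proof.
have VM : vertices (matching t) = setT by [].
split=> [/existsP[S /and3P[_ /eqP cS /existsP[g /and3P[]]]] |].
  rewrite VM in cS *; move=> /dinjectiveP g_inj gS /forall_inP gE.
  have {}g_inj : injective g by move=> x y; apply: g_inj; rewrite inE.
  (* The trace lives on exactly as many vertices as the matching has, so every
     vertex of [S] is an end of one of its edges. *)
  have defS : g @: setT = S.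
    by apply/eqP; rewrite eqEcard (gS : _ \subset S) cS card_imset /=.
  have ex_e i : exists2 e, e \in edges H
      & g @: [set (i, false); (i, true)] = e :&: S.
    by apply/imsetP; apply: gE; apply: imset_f.
  have {ex_e} /(_ _)/cid2 ex_e := ex_e.
  exists (fun i c => g (i, c)), (fun i => projT1 (ex_e i)).
  split=> [i|i|i c j]; first by case: (ex_e i).
    by rewrite (inj_eq g_inj) xpair_eqE andbF.
  case: (ex_e j) => /= e eE eS.
  have -> : (g (i, c) \in e) = (g (i, c) \in e :&: S).
    by rewrite inE -defS imset_f ?andbT.
  by rewrite -eS mem_imset // !inE !xpair_eqE; case: c; case: (i == j).
case=> p [e [eE p_neq pe]].
pose g := [ffun x : 'I_t * bool => p x.1 x.2].
have g_inj : injective g.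
  move=> [i c] [j d]; rewrite !ffunE /= => pp.
  have ij : i = j by apply/eqP; rewrite -(pe _ c) pp pe.
  move: pp (p_neq j); rewrite ij.
  by case: c; case: d => // ->; rewrite eqxx.
apply/existsP; exists (g @: setT).
rewrite VM card_imset // eqxx /=; apply/andP; split.
  apply/subsetP => _ /imsetP[[i c] _ ->]; rewrite ffunE /=.
  by apply: (subsetP (edge_sub_vertices (eE i))); rewrite pe.
apply/existsP; exists g; apply/and3P; split=> //.
  by apply/dinjectiveP => x y _ _; apply: g_inj.
apply/forall_inP => _ /imsetP[i _ ->]; apply/imsetP; exists (e i) => //.
apply/setP => x; apply/imsetP/setIP => [[[j c] jc ->]|[xe]].
  split; last exact: imset_f.
  by move: jc; rewrite ffunE /= pe !inE !xpair_eqE => /orP[]/andP[].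
case/imsetP=> [[j c] _ xj]; exists (j, c) => //.
move: xe; rewrite xj ffunE /= pe => /eqP->.
by rewrite !inE !xpair_eqE eqxx; case: c {xj}.
Qed.

(** * Adding a vertex to each edge *)

Lemma max_edges_phi_attained (r s : nat) :
  exists (T : finType) (G : hypergraph T),
    [/\ uniform r G, phi G <= s & #|edges G| = max_edges_phi r s].
Proof. by rewrite /max_edges_phi; case: ex_maxnP => m /asboolP. Qed.

Lemma card_edges_le_max (T : finType) (G : hypergraph T) (r s : nat) :
  uniform r G -> phi G <= s -> #|edges G| <= max_edges_phi r s.
Proof.
move=> uG phiG; rewrite /max_edges_phi; case: ex_maxnP => m _; apply.
by apply/asboolP; exists T, G.
Qed.

Lemma card_add_vertex (T : finType) (V : {set T}) (E : {set {set T}}) :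
  [disjoint V & cover E] ->
  #|[set v |: e | v in V, e in E]| = #|V| * #|E|.
Proof.
move=> dVE; rewrite curry_imset2X card_in_imset ?cardsX // => -[v e] [w d].
rewrite !inE /= => /andP[vV eE] /andP[wV dE] eq_ve.
have Vcov x : x \in V -> forall a, a \in E -> x \notin a.
  move=> xV a aE; have := disjointFr dVE xV.
  by apply: contraFN => xa; apply/bigcupP; exists a.
have /eqP vw : v == w.
  have := setU11 v e; rewrite eq_ve !inE => /orP[//|].
  by rewrite (negPf (Vcov _ vV _ dE)).
subst w; congr pair.
by rewrite -(setU1K (Vcov _ vV _ eE)) eq_ve setU1K ?Vcov.
Qed.

(** A private pair of [v |: g] has a member other than [v]; it lies in [g], and
    it is private in [G] because the other edges of [G] are contained in the
    corresponding edges of [H]. *)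
Lemma no_matching_trace_cone (T : finType) (G H : hypergraph T)
    (V : {set T}) (s : nat) :
  phi G <= s -> edges H = [set v |: e | v in V, e in edges G] ->
  ~~ contains_trace (matching s.+1) H.
Proof.
move=> phiG EH; apply: contraL phiG => /contains_matching_traceP.
case=> p [e [eE p_neq pe]]; rewrite -ltnNge; apply/phi_gtP.
have ex_g i : exists a g, [/\ g \in edges G, g \subset e i, a \in g
                            & exists c, a = p i c].
  have := eE i; rewrite EH => /imset2P[v g vV gE def_e].
  have [c pv] : exists c, p i c != v.
    have [pf|] := eqVneq (p i false) v; last by exists false.
    by exists true; rewrite -pf eq_sym.
  exists (p i c), g; split=> //; last by exists c.
    by rewrite def_e subsetUr.
  by have := pe i c i; rewrite eqxx def_e !inE (negPf pv).
have [a ag] := choice ex_g; have [g agP] := choice ag.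
exists a, g; split=> [i|i j]; first by have [] := agP i.
have [_ _ ai [c pi]] := agP i; have [_ gj _ _] := agP j.
apply/idP/eqP => [aj|<- //].
by apply/eqP; rewrite -(pe i c) -pi (subsetP gj).
Qed.

(** The defect [#|edges G| * (s * r)] is the number of edges lost because the
    added vertex may not be one of the at most [s * r] vertices of [G]. *)
Lemma cone_extremal (T : finType) (G H : hypergraph T) (r s : nat) :
  uniform r G -> phi G <= s -> no_isolated G ->
  vertices G \subset vertices H ->
  edges H = [set v |: e | v in vertices H :\: vertices G, e in edges G] ->
  [/\ uniform r.+1 H, ~~ contains_trace (matching s.+1) H
    & #|edges G| * #|vertices H| <=
        #|edges H| + #|edges G| * (s * r) /\
      #|edges H| <= #|edges G| * #|vertices H|].
Proof.
move=> uG phiG isoG sGH EH; split.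
- apply/forall_inP => f; rewrite EH => /imset2P[v e].
  rewrite !inE => /andP[vG _] eE ->; rewrite cardsU1 (card_edge uG eE).
  by rewrite (contra (subsetP (edge_sub_vertices eE) v) vG).
- exact: no_matching_trace_cone phiG EH.
have cov_sub : cover (edges G) \subset vertices G.
  by apply/bigcupsP => e; apply: edge_sub_vertices.
have sub_cov : vertices G \subset cover (edges G).
  apply/subsetP => v /(forall_inP isoG)/exists_inP[e eE ve].
  by apply/bigcupP; exists e.
have VG : #|vertices G| <= s * r.
  apply: leq_trans (subset_leq_card sub_cov) _.
  by apply: leq_trans (card_cover_phi uG) _; rewrite leq_mul2r phiG orbT.
have -> : #|edges H| = (#|vertices H| - #|vertices G|) * #|edges G|.
  rewrite EH card_add_vertex ?cardsDS // disjoints_subset.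
  apply: subset_trans (_ : ~: vertices G \subset _); first exact: subsetDr.
  by rewrite setCS.
have := subset_leq_card sGH.
split; nia.
Qed.

(** * The lower bound *)

Lemma inject_into_ord (T : finType) (V : {set T}) (n : nat) :
  0 < n -> #|V| <= n -> exists h : T -> 'I_n, {in V &, injective h}.
Proof.
case: n => // n _ Vn; exists (fun x => inord (index x (enum V))).
move=> x y xV yV /(congr1 val).
have enumV z : z \in V -> z \in enum V by rewrite mem_enum.
have idx z : z \in V -> index z (enum V) < n.+1.
  by move=> zV; apply: leq_trans Vn; rewrite cardE index_mem; exact: enumV.
rewrite /= !inordK ?idx //.
by apply: (index_inj x); apply: enumV.
Qed.

Lemma image_edges_sub (T U : finType) (E : {set {set T}}) (h : T -> U) :
  [forall e in [set h @: e | e : {set T} in E], e \subset h @: cover E].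
Proof.
apply/forall_inP => _ /imsetP[e eE ->].
by apply: imsetS; apply: bigcup_sup.
Qed.

(** Only the non-isolated vertices of [G] are kept: [card_cover_phi] bounds
    their number, so that they fit into [n] points for large [n]. *)
Definition image_hypergraph (T U : finType) (h : T -> U) (G : hypergraph T) :=
  @Hypergraph U (h @: cover (edges G), [set h @: e | e : {set T} in edges G])
    (image_edges_sub (edges G) h).

(** An optimal hypergraph for [max_edges_phi] may live on an arbitrary finite
    type; this moves it onto the vertex set where it is needed. *)
Lemma image_hypergraph_extremal (T U : finType) (h : T -> U)
    (G : hypergraph T) (r s : nat) :
  {in cover (edges G) &, injective h} -> uniform r G -> phi G <= s ->
  let G' := image_hypergraph h G in
  [/\ uniform r G', phi G' <= s, no_isolated G' & #|edges G'| = #|edges G|].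
Proof.
move=> h_inj uG phiG G'.
have cov e x : e \in edges G -> x \in e -> x \in cover (edges G).
  by move=> eE xe; apply/bigcupP; exists e.
have mem_h e x : e \in edges G -> x \in cover (edges G) ->
    (h x \in h @: e) = (x \in e).
  move=> eE xV; apply/imsetP/idP => [[y ye /h_inj->] //|xe]; last by exists x.
  exact: cov ye.
split.
- apply/forall_inP => _ /imsetP[e eE ->].
  rewrite card_in_imset ?(card_edge uG eE) // => x y xe ye.
  by apply: h_inj; apply: cov eE _.
- rewrite leqNgt; apply: contraL phiG => /phi_gtP[a [e [eE ae]]].
  rewrite -ltnNge; apply/phi_gtP.
  have /choice[f fP] i : exists f, f \in edges G /\ e i = h @: f.
    by have /imsetP[f] := eE i; exists f.
  have /choice[b bP] i : exists x, x \in f i /\ a i = h x.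
    have [_ ef] := fP i.
    have /imsetP[x] : a i \in h @: f i by rewrite -ef ae.
    by exists x.
  exists b, f; split=> [i|i j]; first by have [] := fP i.
  have [[fiE _] [fjE ej]] := (fP i, fP j); have [bi ai] := bP i.
  by rewrite -ae ai ej mem_h // (cov _ _ fiE).
- apply/forall_inP => _ /imsetP[x /bigcupP[e eE xe] ->].
  by apply/exists_inP; exists (h @: e); rewrite imset_f.
apply: card_in_imset => e e' eE e'E ee'.
apply/setP => x; apply/idP/idP => xe.
  by rewrite -(mem_h e') ?(cov e) // -ee' imset_f.
by rewrite -(mem_h e) ?(cov e') // ee' imset_f.
Qed.

Lemma ex_matching_trace_ge (r s n : nat) :
  0 < n -> s * r <= n ->
  max_edges_phi r s * n <=
    ex_trace r.+1 n (matching s.+1) + max_edges_phi r s * (s * r).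
Proof.
move=> n0 sn; have [T [G [uG phiG cG]]] := max_edges_phi_attained r s.
have [|h h_inj] := @inject_into_ord T (cover (edges G)) n n0.
  apply: leq_trans (card_cover_phi uG) (leq_trans _ sn).
  by rewrite leq_mul2r phiG orbT.
have [] := image_hypergraph_extremal h_inj uG phiG.
set G' := image_hypergraph h G => uG' phiG' isoG' cG'.
pose E := [set v |: e | v in setT :\: vertices G', e in edges G'].
have ET : [forall e in E, e \subset [set: 'I_n]].
  by apply/forall_inP => e _; apply: subsetT.
pose H := @Hypergraph 'I_n (setT, E) ET.
have [//|uH nH [geH _]] :=
  cone_extremal (H := H) uG' phiG' isoG' (subsetT _).
rewrite -cG -cG'; rewrite cardsT card_ord in geH.
apply: leq_trans geH _; rewrite leq_add2r.
rewrite /ex_trace (bigmax_sup H) //.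
by rewrite uH nH cardsT card_ord eqxx.
Qed.

(** * A bounded set missing at most one vertex of each edge *)

(** Members of [C] meet each other only inside [W], so any two vertices of a
    member outside [W] are private to it. *)
Lemma matching_trace_of_sunflower (T : finType) (H : hypergraph T)
    (W : {set T}) (C : {set {set T}}) (t : nat) :
  C \subset edges H -> t <= #|C| ->
  (forall e, e \in C -> 1 < #|e :\: W|) ->
  {in C &, forall e f, e != f -> e :&: f \subset W} ->
  contains_trace (matching t) H.
Proof.
move=> CE tC big_petal disj; apply/contains_matching_traceP.
have tCi (i : 'I_t) : i < #|C| by rewrite (leq_trans (ltn_ord i)).
pose e i := enum_val (Ordinal (tCi i)).
have eC i : e i \in C by apply: enum_valP.
have e_inj i j : (e i == e j) = (i == j).
  by rewrite (inj_eq enum_val_inj) -val_eqE.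
have ex_p i : exists q : bool -> T,
    q false != q true /\ forall c, q c \in e i :\: W.
  have /card_gt1P[x [y [xe ye xy]]] := big_petal _ (eC i).
  by exists (fun c => if c then y else x); split=> // -[].
have [p pP] := choice ex_p.
exists p, e; split=> [i|i|i c j]; first exact: (subsetP CE).
  by have [] := pP i.
have [_ /(_ c)/setDP[pe pW]] := pP i.
apply/idP/eqP => [pj|<- //]; apply/eqP; rewrite -e_inj.
apply: contraR pW => /(disj _ _ (eC i) (eC j))/subsetP; apply.
by rewrite inE pe.
Qed.

(** Among the edges that meet [W] in [A], take a maximal family whose members
    are pairwise disjoint outside [W].  It has at most [s] members, as it would
    give an [M_(s+1)] trace otherwise, and by maximality every such edge meets
    one of them outside [W]. *)
Lemma petals_meet_bounded_set (T : finType) (H : hypergraph T) (r s : nat)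
    (W A : {set T}) :
  uniform r H -> ~~ contains_trace (matching s.+1) H -> #|A| + 2 <= r ->
  exists2 U : {set T}, #|U| <= s * r
    & forall e, e \in edges H -> e :&: W = A -> ~~ (e :&: U \subset W).
Proof.
move=> uH nH Ar.
pose P (C : {set {set T}}) :=
  [&& C \subset edges H, [forall e in C, e :&: W == A] &
      [forall e in C, forall f in C, (e != f) ==> (e :&: f \subset W)]].
have P0 : P set0.
  rewrite /P sub0set /=.
  by apply/andP; split; apply/forall_inP => e; rewrite inE.
have petal e : e \in edges H -> e :&: W = A -> 1 < #|e :\: W|.
  by move=> eE eA; have := cardsID W e; rewrite eA (card_edge uH eE); lia.
have [C /maxsetP[/and3P[CE /forall_inP CA /forall_inP Cdisj] maxC] _] :=
  maxset_exists P0.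
have {}Cdisj : {in C &, forall e f, e != f -> e :&: f \subset W}.
  by move=> e f /Cdisj/forall_inP fC /fC/implyP.
have eqA e : e \in C -> e :&: W = A by move=> /CA/eqP.
exists (cover C).
  apply: leq_trans (leq_card_cover C) _.
  apply: (@leq_trans (\sum_(e in C) r)).
    by apply: leq_sum => e eC; rewrite (card_edge uH) // (subsetP CE).
  rewrite sum_nat_const leq_mul2r leqNgt; apply/orP; right.
  apply: contra nH => sC.
  apply: (matching_trace_of_sunflower CE sC _ Cdisj) => e eC.
  by apply: petal (eqA _ eC); apply: (subsetP CE).
move=> e eE eA; apply/negP => /subsetP eCW.
have meetW f : f \in C -> e :&: f \subset W.
  move=> fC; apply/subsetP => x /setIP[xe xf]; apply: eCW; rewrite inE xe.
  by apply/bigcupP; exists f.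
have eC : e \in C.
  rewrite -(maxC (e |: C)) ?setU11 ?subsetUr //; apply/and3P; split.
  - by rewrite subUset sub1set eE.
  - by apply/forall_inP => f /setU1P[->|/CA //]; rewrite eA.
  apply/forall_inP => f fC; apply/forall_inP => g gC; apply/implyP => fg.
  move: fC gC fg => /setU1P[->|fC] /setU1P[->|gC]; rewrite ?eqxx //.
  - by move=> _; apply: meetW.
  - by move=> _; rewrite setIC; apply: meetW.
  exact: Cdisj.
(* Being a member of [C], the edge [e] lies in the union of [C], and hence in
   [W], although it has vertices outside [W]. *)
have /card_gt1P[x [y [/setDP[xe xW] _ _]]] := petal e eE eA.
by have := subsetP (meetW e eC) x; rewrite !inE xe (negPf xW) => /(_ isT).
Qed.

(** One step adds a set of at most [b] vertices for each subset of the
    current core. *)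
Fixpoint core_bound (b j : nat) : nat :=
  if j is j'.+1 then core_bound b j' + 2 ^ core_bound b j' * b else 0.

(** By induction on [j]: for each possible intersection [A] with the current
    core [W] the core is enlarged by a set that stabs all edges meeting [W] in
    [A].  So every edge with at least two vertices outside [W] gains a vertex in
    the core, and the other edges already have at least [r - 1], hence more than
    [j], vertices there. *)
Lemma core_exists (T : finType) (H : hypergraph T) (r s j : nat) :
  uniform r H -> ~~ contains_trace (matching s.+1) H -> j < r ->
  exists2 W : {set T}, #|W| <= core_bound (s * r) j
    & forall e, e \in edges H -> j <= #|e :&: W|.
Proof.
move=> uH nH; elim: j => [_|j IHj jr]; first by exists set0; rewrite ?cards0.
have [W cW We] := IHj (ltnW jr).
have ex_U (A : {set T}) : exists U : {set T}, #|U| <= s * r /\ (#|A| + 2 <= r ->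
    forall e, e \in edges H -> e :&: W = A -> ~~ (e :&: U \subset W)).
  have [Ar|rA] := leqP (#|A| + 2) r; last first.
    by exists set0; rewrite cards0.
  by have [U cU UP] := petals_meet_bounded_set W uH nH Ar; exists U.
have [U UP] := choice ex_U.
exists (W :|: \bigcup_(A in powerset W) U A) => [|e eE] /=.
  rewrite (leq_trans (leq_card_setU _ _)) // leq_add //.
  have le_cover : #|\bigcup_(A in powerset W) U A| <=
                  \sum_(A in powerset W) #|U A|.
    elim/big_rec2: _ => [|A n B _ Bn]; first by rewrite cards0.
    by rewrite (leq_trans (leq_card_setU _ _)) // leq_add2l.
  apply: leq_trans le_cover _.
  apply: (@leq_trans (\sum_(A in powerset W) s * r)).
    by apply: leq_sum => A _; case: (UP A).
  by rewrite sum_nat_const card_powerset leq_mul2r leq_exp2l // cW orbT.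
have [large|] := leqP r (#|e :&: W| + 1).
  apply: (@leq_trans #|e :&: W|); first by lia.
  by rewrite subset_leq_card // setIS // subsetUl.
move=> small; have [_ /(_ _ e eE erefl)] := UP (e :&: W).
move=> /(_ ltac:(lia))/subsetPn[x /setIP[xe xU] xW].
apply: leq_ltn_trans (We e eE) (proper_card _).
apply/properP; split; first by rewrite setIS ?subsetUl.
exists x; last by rewrite inE xe.
rewrite !inE xe /=; apply/orP; right; apply/bigcupP.
by exists (e :&: W); rewrite ?powersetE ?subsetIr.
Qed.

(** * The upper bound *)

Definition extensions (T : finType) (H : hypergraph T) (W A : {set T}) :
    {set T} :=
  [set v in ~: W | v |: A \in edges H].

Definition heavy_sets (T : finType) (H : hypergraph T) (W : {set T})
    (r s : nat) : {set {set T}} :=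
  [set A in powerset W | (#|A| == r) && (s < #|extensions H W A|)].

Lemma heavy_sets_sub (T : finType) (H : hypergraph T) (W : {set T})
    (r s : nat) :
  [forall A in heavy_sets H W r s, A \subset W].
Proof. by apply/forall_inP => A; rewrite !inE => /andP[]. Qed.

Definition heavy_hypergraph (T : finType) (H : hypergraph T) (W : {set T})
    (r s : nat) : hypergraph T :=
  @Hypergraph T (W, heavy_sets H W r s) (heavy_sets_sub H W r s).

(** Hall's condition holds trivially here: the vertices can be chosen greedily,
    as fewer than [t] are excluded at each step. *)
Lemma distinct_representatives (T : finType) (t : nat) (X : 'I_t -> {set T}) :
  (forall i, t <= #|X i|) ->
  exists2 v : 'I_t -> T, injective v & forall i, v i \in X i.
Proof.
case: t X => [X _|t X cX].
  have v : 'I_0 -> T by case.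
  by exists v => -[].
suff [v vP] : exists v : nat -> T,
    forall i, i < t.+1 -> v i \in X (inord i) /\ forall j, j < i -> v j != v i.
  exists (fun i : 'I_t.+1 => v i) => [i j vij|i]; last first.
    by have [] := vP i (ltn_ord i); rewrite inord_val.
  apply: val_inj => /=.
  case: (ltngtP i j) => // [ij|ji].
    by have [_ /(_ i ij)] := vP j (ltn_ord j); rewrite vij eqxx.
  by have [_ /(_ j ji)] := vP i (ltn_ord i); rewrite vij eqxx.
suff: forall m, m <= t.+1 -> exists v : nat -> T,
    forall i, i < m -> v i \in X (inord i) /\ forall j, j < i -> v j != v i.
  by apply.
elim=> [_|m IHm mt].
  have /card_gt0P[x _] : 0 < #|X ord0| by apply: leq_trans (cX _).
  by exists (fun=> x).
have [v vP] := IHm (ltnW mt).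
have /subsetPn[x xX xv] : ~~ (X (inord m) \subset [set v (val i) | i : 'I_m]).
  apply: contraL mt => /subset_leq_card/leq_trans/(_ (leq_imset_card _ _)).
  by rewrite card_ord -leqNgt => /(leq_trans (cX _)).
exists (fun i => if i == m then x else v i) => i.
rewrite ltnS leq_eqVlt => /orP[/eqP->|im].
  rewrite eqxx; split=> // j jm; rewrite ltn_eqF //.
  by apply: contraNneq xv => <-; apply/imsetP; exists (Ordinal jm).
rewrite ltn_eqF //; have [viX vij] := vP i im; split=> // j ji.
by rewrite ltn_eqF ?vij // (ltn_trans ji).
Qed.

(** Each of [s + 1] heavy sets with a private vertex in [W] has more than [s]
    extending vertices, so distinct ones can be chosen; being outside [W], such
    a vertex belongs to no other of the chosen edges. *)
Lemma phi_heavy_le (T : finType) (H : hypergraph T) (W : {set T})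
    (r s : nat) :
  ~~ contains_trace (matching s.+1) H -> phi (heavy_hypergraph H W r s) <= s.
Proof.
apply: contraR; rewrite -ltnNge => /phi_gtP[a [g [gE ag]]].
have gP i : [/\ g i \subset W & s < #|extensions H W (g i)|].
  by have := gE i; rewrite !inE => /and3P[].
have [|v v_inj vX] :=
  distinct_representatives (X := fun i => extensions H W (g i)).
  by move=> i; have [] := gP i.
have vW i : v i \notin W by have := vX i; rewrite !inE => /andP[].
have aW i : a i \in W.
  by have [/subsetP gW _] := gP i; apply: gW; rewrite ag.
have av i j : a i != v j by apply: contraNneq (vW j) => <-.
apply/contains_matching_traceP.
exists (fun i c => if c then v i else a i), (fun i => v i |: g i).
split=> [i|i|i [] j] //.
- by have := vX i; rewrite !inE => /andP[].
- rewrite !inE (inj_eq v_inj); have [/subsetP gW _] := gP j.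
  by rewrite (contraNF (gW _)) ?orbF.
by rewrite !inE (negPf (av i j)) ag.
Qed.

(** The edges are grouped by their intersection [A] with [W].  If [A] has
    [r.+1] vertices it is the only edge of its group; if it has [r] vertices,
    the group has one edge for each extending vertex: at most [s] of them
    unless [A] is heavy. *)
Lemma card_edges_heavy (T : finType) (H : hypergraph T) (W : {set T})
    (r s : nat) :
  0 < s -> uniform r.+1 H -> (forall e, e \in edges H -> r <= #|e :&: W|) ->
  #|edges H| <= #|heavy_sets H W r s| * #|vertices H| + 2 ^ #|W| * s.
Proof.
move=> s_gt0 uH We.
pose fibre A := [set e in edges H | e :&: W == A].
have fibreE A e : e \in fibre A -> [/\ e \in edges H, e :&: W = A & r <= #|A|].
  by rewrite inE => /andP[eE /eqP eA]; rewrite -eA We.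
have le_fibre A : #|fibre A| <=
    (A \in heavy_sets H W r s) * #|vertices H| + s.
  have [Ar|Ar|Ar] := ltngtP #|A| r.
  - rewrite (_ : fibre A = set0) ?cards0 //; apply/setP => e; rewrite in_set0.
    by apply/negbTE/negP => /fibreE[_ _]; rewrite leqNgt Ar.
  - apply: leq_trans (_ : 1 <= _); last by rewrite (leq_trans s_gt0) ?leq_addl.
    rewrite -(cards1 A); apply/subset_leq_card/subsetP => e /fibreE[eE eA _].
    rewrite inE; apply/eqP; rewrite -eA; apply/esym/eqP.
    by rewrite eqEcard subsetIl (card_edge uH eE) eA.
  have [AW|nAW] := boolP (A \subset W); last first.
    rewrite (_ : fibre A = set0) ?cards0 //; apply/setP => e; rewrite in_set0.
    by apply: contraNF nAW => /fibreE[_ <- _]; apply: subsetIr.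
  have sub_ext : fibre A \subset [set v |: A | v in extensions H W A].
    apply/subsetP => e /fibreE[eE eA _].
    have /eqP/cards1P[v ev] : #|e :\: W| = 1.
      by have := cardsID W e; rewrite eA (card_edge uH eE); lia.
    have def_e : e = v |: A by rewrite -(setID e W) eA ev setUC.
    apply/imsetP; exists v => //; rewrite !inE -def_e eE andbT.
    by have := set11 v; rewrite -ev inE => /andP[].
  have := leq_trans (subset_leq_card sub_ext) (leq_imset_card _ _).
  rewrite !inE AW Ar eqxx /=.
  have ext_vertices : extensions H W A \subset vertices H.
    apply/subsetP => v; rewrite !inE => /andP[_ /edge_sub_vertices/subsetP].
    by apply; rewrite setU11.
  have := subset_leq_card ext_vertices.
  by case: ltnP; lia.
have -> : #|edges H| = \sum_(A in powerset W) #|fibre A|.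
  rewrite -sum1_card (partition_big (fun e => e :&: W) (mem (powerset W))) /=.
    apply: eq_bigr => A _; rewrite -sum1_card.
    by apply: eq_bigl => e; rewrite inE.
  by move=> e _; rewrite powersetE subsetIr.
apply: (@leq_trans (\sum_(A in powerset W)
    ((A \in heavy_sets H W r s) * #|vertices H| + s))).
  by apply: leq_sum => A _; apply: le_fibre.
rewrite big_split /= sum_nat_const card_powerset leq_add2r.
rewrite -big_distrl /= leq_mul2r; apply/orP; right.
rewrite -sum1_card big_mkcond /= [X in _ <= X]big_mkcond /=.
by apply: leq_sum => A _; case: ifP; case: (A \in heavy_sets _ _ _ _).
Qed.

(** The heavy hypergraph of a core competes in the definition of
    [max_edges_phi r s], and the number of light sets is at most the number of
    subsets of the core. *)
Lemma ex_matching_trace_le (r s n : nat) :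
  0 < s ->
  ex_trace r.+1 n (matching s.+1) <=
    max_edges_phi r s * n + 2 ^ core_bound (s * r.+1) r * s.
Proof.
move=> s_gt0; apply/bigmax_leqP => H /and3P[/eqP VH uH nH].
have [W cW We] := core_exists uH nH (ltnSn r).
apply: leq_trans (card_edges_heavy s_gt0 uH We) _.
rewrite VH leq_add // leq_mul2r; last by rewrite leq_exp2l // cW orbT.
apply/orP; right; apply: (@card_edges_le_max _ (heavy_hypergraph H W r s)).
  by apply/forall_inP => A; rewrite !inE => /and3P[].
exact: phi_heavy_le.
Qed.

Theorem theorem1p2 (r s : nat) (hr : 2 <= r) (hs : 1 <= s) :
  (exists n0 C : nat, forall n : nat, n0 <= n ->
     (`|(ex_trace r n (matching s.+1))%:Z - (max_edges_phi (r - 1) s * n)%:Z|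
        <= C%:Z)%R)
  /\
  (exists C : nat, forall (T : finType) (n : nat) (G H : hypergraph T),
     uniform (r - 1) G ->
     #|edges G| = max_edges_phi (r - 1) s ->
     phi G <= s ->
     no_isolated G ->
     #|vertices H| = n ->
     vertices G \subset vertices H ->
     edges H = [set v |: e | v in vertices H :\: vertices G, e in edges G] ->
     [/\ uniform r H,
         ~~ contains_trace (matching s.+1) H
       & (`|#|edges H|%:Z - (max_edges_phi (r - 1) s * n)%:Z| <= C%:Z)%R]).
Proof.
case: r hr => [//|r] hr; rewrite subn1 /=; split.
  exists (s * r).+1.
  exists (max_edges_phi r s * (s * r) + 2 ^ core_bound (s * r.+1) r * s).
  move=> n n0; have := ex_matching_trace_le r n hs.
  have := @ex_matching_trace_ge r s n (leq_ltn_trans (leq0n _) n0) (ltnW n0).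
  lia.
exists (max_edges_phi r s * (s * r)) => T n G H uG cG phiG isoG VH sGH EH.
have [uH nH [geH leH]] := cone_extremal uG phiG isoG sGH EH.
split=> //; rewrite -VH -cG.
by move: geH leH; move: #|edges H| (_ * #|_|) (_ * (s * r)) => a b c; lia.
Qed.
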